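(* Let $R$ be a regularly subperfect ring, $I$ a proper ideal of $R$, and let $n \ge 0$ be an integer. The following are equivalent: (1) $I$ has height $n$. (2) Every maximal regular sequence in $I$ has length $n$. (3) There exists a maximal regular sequence in $I$ of length $n$. (4) $n = \min\{t : \operatorname{Ext}^t_R(R/I,R)\neq 0\}$.
   Context: All rings are commutative with identity. A ring is perfect if every flat module over it is projective (equivalently, it satisfies the descending chain condition on principal ideals). $Q(A)$ denotes the total quotient ring of a ring $A$, and $A$ is subperfect if $Q(A)$ is perfect. A sequence $x_1,\ldots,x_i$ in $A$ is a regular sequence if $(x_1,\ldots,x_i)A\neq A$ and each $x_j$ is a non-zero-divisor on $A/(x_1,\ldots,x_{j-1})A$; the empty sequence is considered a regular sequence. A ring $A$ is regularly subperfect if for each regular sequence $x_1,\ldots,x_i$ in $A$ (including the empty one) the ring $A/(x_1,\ldots,x_i)A$ is subperfect. A maximal regular sequence in $I$ is a regular sequence of $R$ with all terms in $I$ that cannot be extended to a longer such sequence by appending an element of $I$. In (4), $t$ ranges over the non-negative integers.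
   Formalization: Condition (2) is stated as ''maximal regular sequences in I exist and every one has length n''; read vacuously, (2) fails to imply the others, e.g. for I = (x_1, x_2, ...) in k[x_1, x_2, ...], which contains no maximal regular sequence. *)

(* Defs.v *)
From HB Require Import structures.
From mathcomp Require Import all_boot all_algebra.
From mathcomp Require Import boolp.
From mathcomp Require Import freeg ring.

Set Implicit Arguments.
Unset Strict Implicit.
Unset Printing Implicit Defensive.

Import GRing.Theory.
Local Open Scope ring_scope.
Local Open Scope quotient_scope.

(* Total quotient ring: fractions with denominator a non-zero-divisor.  In a
   commutative ring left-regular elements are the non-zero-divisors, and
   since denominators are regular, a / s = b / t iff a t = b s. *)
Section TotalQuotientRing.
Variable A : comNzRingType.

Definition nonzerodiv : Type := {s : A | `[< GRing.lreg s >]}.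
Implicit Types (s t : nonzerodiv) (u v w : A * nonzerodiv).

Lemma nonzerodivP s : GRing.lreg (sval s).
Proof. by apply/asboolP; exact: (valP s). Qed.

Lemma nonzerodiv1_subproof : `[< GRing.lreg (1 : A) >].
Proof. by apply/asboolP/lreg1. Qed.
Definition nonzerodiv1 : nonzerodiv := exist _ 1 nonzerodiv1_subproof.

Lemma nonzerodivM_subproof s t : `[< GRing.lreg (sval s * sval t) >].
Proof. by apply/asboolP/lregM; exact: nonzerodivP. Qed.
Definition nonzerodivM s t : nonzerodiv :=
  exist _ (sval s * sval t) (nonzerodivM_subproof s t).

Definition frac_eq u v : bool := u.1 * sval v.2 == v.1 * sval u.2.

Lemma frac_eq_equiv : equiv_class_of frac_eq.
Proof.
split=> [u|u v|v u w]; rewrite /frac_eq; first exact: eqxx.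
  by rewrite eq_sym.
move=> /eqP e1 /eqP e2; apply/eqP/(@nonzerodivP v.2).
transitivity (v.1 * sval u.2 * sval w.2); first by rewrite -e1; ring.
by transitivity (w.1 * sval v.2 * sval u.2); [rewrite -e2|]; ring.
Qed.

Canonical frac_eq_canonical := EquivRelPack frac_eq_equiv.
Canonical frac_eq_encModRel := defaultEncModRel frac_eq.

Definition total_quot := {eq_quot frac_eq}.

HB.instance Definition _ : EqQuotient _ frac_eq total_quot :=
  EqQuotient.on total_quot.
HB.instance Definition _ := Choice.on total_quot.

Definition frac_add u v : A * nonzerodiv :=
  (u.1 * sval v.2 + v.1 * sval u.2, nonzerodivM u.2 v.2).
Definition frac_opp u : A * nonzerodiv := (- u.1, u.2).
Definition frac_mul u v : A * nonzerodiv :=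
  (u.1 * v.1, nonzerodivM u.2 v.2).

Definition tq_zero := lift_cst total_quot (0, nonzerodiv1).
Definition tq_one := lift_cst total_quot (1, nonzerodiv1).
Definition tq_add := lift_op2 total_quot frac_add.
Definition tq_opp := lift_op1 total_quot frac_opp.
Definition tq_mul := lift_op2 total_quot frac_mul.

Canonical pi_tq_zero := PiConst tq_zero.
Canonical pi_tq_one := PiConst tq_one.

Lemma frac_eqP u v : reflect (u.1 * sval v.2 = v.1 * sval u.2)
  (u == v %[mod total_quot]).
Proof. by rewrite piE /= /frac_eq; exact: eqP. Qed.

Lemma repr_frac u :
  (repr (\pi_total_quot u)).1 * sval u.2 = u.1 * sval (repr (\pi_total_quot u)).2.
Proof. by apply/frac_eqP; rewrite reprK. Qed.

Lemma pi_tq_opp : {morph \pi_total_quot : u / frac_opp u >-> tq_opp u}.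
Proof.
move=> u; unlock tq_opp; apply/eqP/frac_eqP => /=.
by rewrite !mulNr repr_frac.
Qed.
Canonical pi_tq_opp_morph := PiMorph1 pi_tq_opp.

Lemma pi_tq_add : {morph \pi_total_quot : u v / frac_add u v >-> tq_add u v}.
Proof.
move=> u v; unlock tq_add; apply/eqP/frac_eqP => /=.
have := repr_frac u; have := repr_frac v.
set u' := repr (\pi u); set v' := repr (\pi v) => ev eu.
transitivity (u.1 * sval u'.2 * (sval v.2 * sval v'.2)
            + v.1 * sval v'.2 * (sval u.2 * sval u'.2)); first by ring.
by rewrite -eu -ev; ring.
Qed.
Canonical pi_tq_add_morph := PiMorph2 pi_tq_add.

Lemma pi_tq_mul : {morph \pi_total_quot : u v / frac_mul u v >-> tq_mul u v}.
Proof.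
move=> u v; unlock tq_mul; apply/eqP/frac_eqP => /=.
by rewrite mulrACA [RHS]mulrACA !repr_frac.
Qed.
Canonical pi_tq_mul_morph := PiMorph2 pi_tq_mul.

Lemma tq_addA : associative tq_add.
Proof.
elim/quotW=> u; elim/quotW=> v; elim/quotW=> w; rewrite !piE.
by apply/eqP/frac_eqP => /=; ring.
Qed.

Lemma tq_addC : commutative tq_add.
Proof.
elim/quotW=> u; elim/quotW=> v; rewrite !piE.
by apply/eqP/frac_eqP => /=; ring.
Qed.

Lemma tq_add0 : left_id tq_zero tq_add.
Proof.
by elim/quotW=> u; rewrite !piE; apply/eqP/frac_eqP => /=; ring.
Qed.

Lemma tq_addN : left_inverse tq_zero tq_opp tq_add.
Proof.
by elim/quotW=> u; rewrite !piE; apply/eqP/frac_eqP => /=; ring.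
Qed.

HB.instance Definition _ :=
  GRing.isZmodule.Build total_quot tq_addA tq_addC tq_add0 tq_addN.

Lemma tq_mulA : associative tq_mul.
Proof.
elim/quotW=> u; elim/quotW=> v; elim/quotW=> w; rewrite !piE.
by apply/eqP/frac_eqP => /=; ring.
Qed.

Lemma tq_mulC : commutative tq_mul.
Proof.
elim/quotW=> u; elim/quotW=> v; rewrite !piE.
by apply/eqP/frac_eqP => /=; ring.
Qed.

Lemma tq_mul1 : left_id tq_one tq_mul.
Proof.
by elim/quotW=> u; rewrite !piE; apply/eqP/frac_eqP => /=; ring.
Qed.

Lemma tq_mulDl : left_distributive tq_mul tq_add.
Proof.
elim/quotW=> u; elim/quotW=> v; elim/quotW=> w; rewrite !piE.
by apply/eqP/frac_eqP => /=; ring.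
Qed.

Lemma tq_one_neq0 : tq_one != tq_zero.
Proof.
by rewrite !piE /= /frac_eq /= mul1r mul0r oner_neq0.
Qed.

HB.instance Definition _ := GRing.Zmodule_isComNzRing.Build total_quot
  tq_mulA tq_mulC tq_mul1 tq_mulDl tq_one_neq0.

End TotalQuotientRing.

(* Elements of M (x) N are represented by formal sums of pure tensors, i.e.
   by sequences of pairs; [tensor_eq] is equality of the sums they represent
   in the tensor product, i.e. the congruence generated by commutativity and
   bilinearity.  By [TensorDl] and [Tensor0], (- x, y) is opposite to (x, y), so
   the quotient is a group. *)
Inductive tensor_eq (R : comNzRingType) (M N : lmodType R) :
    seq (M * N) -> seq (M * N) -> Prop :=
| TensorRefl s : tensor_eq s s
| TensorSym s t of tensor_eq s t : tensor_eq t s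
| TensorTrans s t u of tensor_eq s t & tensor_eq t u : tensor_eq s u
| TensorCat s s' t t' of tensor_eq s s' & tensor_eq t t' :
    tensor_eq (s ++ t) (s' ++ t')
| TensorCatC s t : tensor_eq (s ++ t) (t ++ s)
| TensorDl x x' y : tensor_eq [:: (x + x', y)] [:: (x, y); (x', y)]
| TensorDr x y y' : tensor_eq [:: (x, y + y')] [:: (x, y); (x, y')]
| TensorZ a x y : tensor_eq [:: (a *: x, y)] [:: (x, a *: y)]
| Tensor0 y : tensor_eq [:: (0, y)] [::].

(* F (x) - preserves injectivity *)
Definition flat (R : comNzRingType) (F : lmodType R) : Prop :=
  forall (M N : lmodType R) (f : {linear M -> N}), injective f ->
  forall s t : seq (F * M),
    tensor_eq [seq (p.1, f p.2) | p <- s] [seq (p.1, f p.2) | p <- t] ->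
    tensor_eq s t.

Definition projective (R : comNzRingType) (P : lmodType R) : Prop :=
  forall (M N : lmodType R) (g : {linear M -> N}) (f : {linear P -> N}),
    (forall y, exists x, g x = y) ->
    exists h : {linear P -> M}, forall x, g (h x) = f x.

Definition perfect (R : comNzRingType) : Prop :=
  forall F : lmodType R, flat F -> projective F.

Definition subperfect (A : comNzRingType) : Prop := perfect (total_quot A).

Section SeqIdeal.
Variable R : comNzRingType.
Implicit Types (xs : seq R) (I : idealr R).

Definition seq_ideal xs : {pred R} :=
  fun y => `[< exists c : nat -> R, y = \sum_(i < size xs) c i * xs`_i >].

(* The first conjunct says (xs)R <> R. *)
Definition regular_seq xs : Prop :=
  1 \notin seq_ideal xs /\
  forall j, (j < size xs)%N -> forall y,
    xs`_j * y \in seq_ideal (take j xs) -> y \in seq_ideal (take j xs).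

Lemma seq_ideal_closed xs : regular_seq xs -> idealr_closed (seq_ideal xs).
Proof.
move=> [n1 _]; split=> // [|a u v /asboolP[c ->] /asboolP[d ->]]; apply/asboolP.
  by exists (fun=> 0); rewrite big1 // => i _; rewrite mul0r.
exists (fun i => a * c i + d i); rewrite mulr_sumr -big_split /=.
by apply: eq_bigr => i _; rewrite mulrDl mulrA.
Qed.

Definition regular_ideal xs (h : regular_seq xs) : idealr R :=
  HB.pack_for (idealr R) (seq_ideal xs : R -> bool)
    (isIdealr.Build R (seq_ideal xs) (seq_ideal_closed h)).

(* Sequences are finite, so an ideal need not contain a maximal one, e.g.
   (x_1, x_2, ...) in k[x_1, x_2, ...] contains none. *)
Definition maximal_regular_seq I xs : Prop :=
  [/\ regular_seq xs, {subset xs <= I} &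
      forall y, y \in I -> ~ regular_seq (rcons xs y)].

End SeqIdeal.

Definition regularly_subperfect (A : comNzRingType) : Prop :=
  forall (xs : seq A) (h : regular_seq xs),
    subperfect {ideal_quot (regular_ideal h)}.

Section Height.
Variable R : comNzRingType.

(* P_0 < P_1 < ... < P_k = P, strictly increasing primes; c i is irrelevant
   for i > k. *)
Definition prime_chain (P : prime_idealr R) (k : nat) : Prop :=
  exists c : nat -> prime_idealr R,
    c k =i P /\
    forall i, (i < k)%N ->
      {subset c i <= c i.+1} /\ ~ {subset c i.+1 <= c i}.

Definition prime_height (P : prime_idealr R) (h : nat) : Prop :=
  prime_chain P h /\ forall k, prime_chain P k -> (k <= h)%N.

(* The height of I is the least height of a prime containing I; primes of
   infinite height satisfy [prime_height P h] for no h. *)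
Definition ideal_height (I : idealr R) (n : nat) : Prop :=
  (exists2 P : prime_idealr R, {subset I <= P} & prime_height P n) /\
  forall P : prime_idealr R, {subset I <= P} ->
    forall h, prime_height P h -> (n <= h)%N.

End Height.

Section IdealQuotientModule.
Variables (R : comNzRingType) (I : idealr R).

Definition ideal_quot_scale (a : R) (x : {ideal_quot I}) : {ideal_quot I} :=
  \pi_{ideal_quot I} a * x.

Lemma ideal_quot_scaleA a b x :
  ideal_quot_scale a (ideal_quot_scale b x) = ideal_quot_scale (a * b) x.
Proof. by rewrite /ideal_quot_scale rmorphM mulrA. Qed.

Lemma ideal_quot_scale1 : left_id 1 ideal_quot_scale.
Proof. by move=> x; rewrite /ideal_quot_scale rmorph1 mul1r. Qed.

Lemma ideal_quot_scaleDr : right_distributive ideal_quot_scale +%R.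
Proof. by move=> a x y; rewrite /ideal_quot_scale mulrDr. Qed.

Lemma ideal_quot_scaleDl x : {morph ideal_quot_scale^~ x : a b / a + b}.
Proof. by move=> a b; rewrite /ideal_quot_scale rmorphD mulrDl. Qed.

HB.instance Definition _ := GRing.Zmodule_isLmodule.Build R {ideal_quot I}
  ideal_quot_scaleA ideal_quot_scale1 ideal_quot_scaleDr ideal_quot_scaleDl.

End IdealQuotientModule.

Section Kernel.
Variables (R : comNzRingType) (U V : lmodType R) (f : {linear U -> V}).

Definition ker_pred : {pred U} := fun x => f x == 0.

Lemma ker_pred_closed : submod_closed ker_pred.
Proof.
split=> [|a x y /eqP fx /eqP fy]; first by apply/eqP; rewrite linear0.
by apply/eqP; rewrite linearP fx fy scaler0 addr0.
Qed.
HB.instance Definition _ :=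
  GRing.isSubmodClosed.Build R U ker_pred ker_pred_closed.

Record ker := Ker { ker_val :> U; _ : ker_val \in ker_pred }.
HB.instance Definition _ := [isSub for ker_val].
HB.instance Definition _ := [Choice of ker by <:].
HB.instance Definition _ := [SubChoice_isSubLmodule of ker by <:].

End Kernel.

(* The standard free resolution ... -> F_1 -> F_0 -> M -> 0: F_t is free on
   the elements of the t-th syzygy Z_t, with Z_0 = M and
   Z_(t+1) = ker (F_t -> Z_t). *)
Section FreeResolution.
Variable R : comNzRingType.

Definition free_lift (K : choiceType) (M : lmodType R) (f : K -> M) :
  {freeg K / R} -> M := fglift f.

Lemma free_lift_zmod_morphism (K : choiceType) (M : lmodType R) (f : K -> M) :
  zmod_morphism (free_lift f).
Proof. exact: lift_is_additive. Qed.
HB.instance Definition _ (K : choiceType) (M : lmodType R) (f : K -> M) :=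
  GRing.isZmodMorphism.Build {freeg K / R} M (free_lift f)
    (free_lift_zmod_morphism f).

Lemma free_lift_scalable (K : choiceType) (M : lmodType R) (f : K -> M) :
  scalable (free_lift f).
Proof.
move=> a D; rewrite -[in RHS](freeg_sumE D).
rewrite -[a *: D]/(fgscale a D) /fgscale !raddf_sum.
by apply: eq_bigr => x _; rewrite /= /free_lift !liftU scalerA.
Qed.
HB.instance Definition _ (K : choiceType) (M : lmodType R) (f : K -> M) :=
  GRing.isScalable.Build R {freeg K / R} M *:%R (free_lift f)
    (free_lift_scalable f).

Lemma free_liftU (K : choiceType) (M : lmodType R) (f : K -> M) x :
  free_lift f << x >> = f x.
Proof. by rewrite /free_lift liftU scale1r. Qed.

Lemma free_lift_ext (K : choiceType) (M : lmodType R)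
    (g : {linear {freeg K / R} -> M}) D : g D = free_lift (fun x => g << x >>) D.
Proof.
rewrite -(freeg_sumE D) !raddf_sum; apply: eq_bigr => x _ /=.
rewrite /free_lift liftU -linearZ /=; congr (g _).
by apply/eqP/freeg_eqP => y; rewrite coeffZ !coeffU mul1r.
Qed.

Lemma free_projective (K : choiceType) :
  projective ({freeg K / R} : lmodType R).
Proof.
move=> M N g f /choice[s gs]; exists (free_lift (fun x => s (f << x >>))) => D.
rewrite [RHS]free_lift_ext; pose h := free_lift (fun x => s (f << x >>)).
rewrite [LHS](free_lift_ext (g \o h)); congr (free_lift _ _).
by apply/funext => x; rewrite /= free_liftU gs.
Qed.

Definition free_cover (M : lmodType R) : {linear {freeg M / R} -> M} :=
  free_lift (fun x : M => x).

Lemma free_cover_surj (M : lmodType R) (x : M) : exists y, free_cover M y = x.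
Proof. by exists << x >>; exact: free_liftU. Qed.

Fixpoint syzygy (M : lmodType R) (t : nat) : lmodType R :=
  if t is t'.+1 then ker (free_cover (syzygy M t')) : lmodType R else M.

Definition free_res (M : lmodType R) (t : nat) : lmodType R :=
  {freeg (syzygy M t) / R}.

Definition free_res_diff (M : lmodType R) (t : nat) :
    {linear free_res M t.+1 -> free_res M t} :=
  (val : {linear ker (free_cover (syzygy M t)) -> free_res M t})
    \o free_cover (syzygy M t.+1).

Lemma free_res_diffE (M : lmodType R) t x :
  (free_cover (syzygy M t) x = 0) <-> (exists y, free_res_diff M t y = x).
Proof.
split=> [kx|[y <-]].
  have kx' : x \in ker_pred (free_cover (syzygy M t)) by apply/eqP.
  have [y yE] := free_cover_surj (Ker kx' : syzygy M t.+1).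
  by exists y; rewrite /free_res_diff /= [free_lift _ y]yE.
by apply/eqP; exact: (valP (free_cover (syzygy M t.+1) y : ker _)).
Qed.

Lemma free_res_exact0 (M : lmodType R) (x : free_res M 0) :
  free_cover M x = 0 <-> exists y, free_res_diff M 0 y = x.
Proof. exact: (@free_res_diffE M 0). Qed.

Lemma free_res_exact (M : lmodType R) t (x : free_res M t.+1) :
  free_res_diff M t x = 0 <-> exists y, free_res_diff M t.+1 y = x.
Proof.
rewrite -free_res_diffE; split=> [dx|cx].
  exact: (@val_inj _ _ (ker (free_cover (syzygy M t)))).
by rewrite /free_res_diff /= [free_lift _ x]cx.
Qed.

(* Ext^t(M, N) is the t-th cohomology of Hom(free_res M, N). *)
Definition ext_cocycle (M N : lmodType R) (t : nat)
    (phi : {linear free_res M t -> N}) : Prop :=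
  forall x, phi (free_res_diff M t x) = 0.

Definition ext_coboundary (M N : lmodType R) (t : nat) :
    {linear free_res M t -> N} -> Prop :=
  match t return {linear free_res M t -> N} -> Prop with
  | 0 => fun phi => forall x, phi x = 0
  | t'.+1 => fun phi => exists psi : {linear free_res M t' -> N},
      forall x, phi x = psi (free_res_diff M t' x)
  end.

Definition Ext_neq0 (M N : lmodType R) (t : nat) : Prop :=
  exists2 phi : {linear free_res M t -> N},
    ext_cocycle phi & ~ ext_coboundary phi.

End FreeResolution.

(* Main.v *)
Require Import Defs.
From HB Require Import structures.
From mathcomp Require Import all_boot all_algebra.
From mathcomp Require Import boolp classical_sets functions ring freeg.

(** Everything rests on one consequence of perfectness, Bass's chain condition
    ([perfect_dcc]): in a perfect ring Q, every descending chain of principal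
    ideals generated by products a_0 ... a_(n-1) stops.  It comes from
    the direct limit B of Q -> Q -> ... along multiplication by a_0, a_1, ....
    B is flat, hence projective, so the map onto B from the eventually
    compatible sequences has a section; the image f of the canonical generator
    under it satisfies f(k) = a_0 ... a_(k-1) for some k, while f(k) is also
    divisible by a_0 ... a_k, because the generator is.

    Let J be an ideal generated by a regular sequence, so that R/J is
    subperfect.  Read in R, the chain condition for Q(R/J) allows a denominator
    that is regular modulo J.  It yields two facts about a prime P containing J
    all of whose elements are zero-divisors modulo J: P is minimal over J
    ([zero_divisors_minimal]), and one element outside J multiplies all of P
    into J ([zero_divisors_annihilated]).  Moreover every ideal of zero-divisors
    modulo J lies in such a prime ([prime_of_zero_divisors]).

    Homologically, if x kills M and is regular on N, then x acts as zero on
    Ext(M, N), so that Ext^t(M, N/xN) vanishes for t < k exactly when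
    Ext^t(M, N) vanishes for t < k + 1.  Applied along a regular sequence of
    length m in I, this gives Ext^t(R/I, R) = 0 for t < m; when the sequence is
    maximal, I consists of zero-divisors modulo it, so Hom(R/I, R/(xs)) <> 0 by
    the annihilation fact, and hence Ext^m(R/I, R) <> 0.  In particular a
    maximal regular sequence is at least as long as any other in I.

    On the side of heights, a regular sequence in a prime produces a chain of
    primes of the same length below it ([prime_chain_regular_seq]).  Conversely
    a chain of primes ending at P produces a regular sequence in P of the same
    length ([regular_seq_prime_chain]): an ideal (ys) and a prime containing it
    that is not minimal over it leave room for one more regular element.  So if
    xs is maximal in I, a prime P above I that consists of zero-divisors modulo
    (xs) has height size xs: xs is maximal in P too, and no regular sequence in
    P is longer. *)

Set Implicit Arguments.
Unset Strict Implicit.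
Unset Printing Implicit Defensive.

Import GRing.Theory.
Local Open Scope ring_scope.
Local Open Scope quotient_scope.

(** * Quotients of modules *)

Section QuotientModule.
Variables (R : nzRingType) (U : lmodType R) (S : {pred U}).
Variable hS : submod_closed S.

Let W : zmodClosed U := HB.pack_for (zmodClosed U) (S : U -> bool)
  (GRing.isZmodClosed.Build U S (GRing.submod_closedB hS)).

(** A separate name keeps this scaling apart from that of ideal quotients, which
    are built on the same quotient group. *)
Definition mod_quot : Type := {ideal_quot W}.
HB.instance Definition _ := GRing.Zmodule.on mod_quot.

Definition mod_quot_pi (x : U) : mod_quot := \pi_{ideal_quot W} x.
Definition mod_quot_scale (r : R) (u : mod_quot) : mod_quot :=
  mod_quot_pi (r *: repr (u : {ideal_quot W})).

Lemma mod_quot_piP x y : mod_quot_pi x = mod_quot_pi y <-> x - y \in S.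
Proof.
by rewrite -[x - y \in S]/(x - y \in W) Quotient.idealrBE; split=> /eqP.
Qed.

Lemma mod_quot_pi_zmod_morphism : zmod_morphism mod_quot_pi.
Proof. by move=> x y; rewrite /mod_quot_pi raddfB. Qed.
HB.instance Definition _ :=
  GRing.isZmodMorphism.Build U mod_quot mod_quot_pi mod_quot_pi_zmod_morphism.

Lemma mod_quot_reprK u : mod_quot_pi (repr (u : {ideal_quot W})) = u.
Proof. exact: reprK. Qed.

Lemma mod_quot_scale_pi r x :
  mod_quot_scale r (mod_quot_pi x) = mod_quot_pi (r *: x).
Proof.
apply/mod_quot_piP; rewrite -scalerBr -[r *: _]addr0.
by apply: hS.2 => //; [apply/mod_quot_piP/mod_quot_reprK|exact: hS.1].
Qed.

Lemma mod_quot_surj u : exists x, u = mod_quot_pi x.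
Proof. by exists (repr (u : {ideal_quot W})); rewrite mod_quot_reprK. Qed.

Lemma mod_quot_scaleA r s u :
  mod_quot_scale r (mod_quot_scale s u) = mod_quot_scale (r * s) u.
Proof. by have [x ->] := mod_quot_surj u; rewrite !mod_quot_scale_pi scalerA. Qed.

Lemma mod_quot_scale1 : left_id 1 mod_quot_scale.
Proof. by move=> u; have [x ->] := mod_quot_surj u; rewrite mod_quot_scale_pi scale1r. Qed.

Lemma mod_quot_scaleDr : right_distributive mod_quot_scale +%R.
Proof.
move=> r u v; have [x ->] := mod_quot_surj u; have [y ->] := mod_quot_surj v.
by rewrite -raddfD !mod_quot_scale_pi scalerDr raddfD.
Qed.

Lemma mod_quot_scaleDl u : {morph mod_quot_scale^~ u : r s / r + s}.
Proof.
move=> r s; have [x ->] := mod_quot_surj u.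
by rewrite !mod_quot_scale_pi scalerDl raddfD.
Qed.

HB.instance Definition _ := GRing.Zmodule_isLmodule.Build R mod_quot
  mod_quot_scaleA mod_quot_scale1 mod_quot_scaleDr mod_quot_scaleDl.

Lemma mod_quot_pi_scalable : scalable mod_quot_pi.
Proof. by move=> r x; rewrite -mod_quot_scale_pi. Qed.
HB.instance Definition _ :=
  GRing.isScalable.Build R U mod_quot *:%R mod_quot_pi mod_quot_pi_scalable.

End QuotientModule.

(** * The Bass module and its chain condition *)

Definition eventually (P : nat -> Prop) : Prop :=
  exists k, forall j, (k <= j)%N -> P j.

Lemma eventuallyT (P : nat -> Prop) : (forall j, P j) -> eventually P.
Proof. by move=> PT; exists 0%N => j _. Qed.

Lemma eventually2 (P1 P2 P : nat -> Prop) :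
  eventually P1 -> eventually P2 -> (forall j, P1 j -> P2 j -> P j) ->
  eventually P.
Proof.
move=> [k P1k] [l P2l] P12; exists (maxn k l) => j.
by rewrite geq_max => /andP[kj lj]; apply: P12; [exact: P1k|exact: P2l].
Qed.

Lemma eventually1 (P1 P : nat -> Prop) :
  eventually P1 -> (forall j, P1 j -> P j) -> eventually P.
Proof. by move=> [k P1k] P1P; exists k => j /P1k/P1P. Qed.

Section BassModule.
Variables (Q : comNzRingType) (a : nat -> Q).

(** The direct limit of Q -> Q -> ... along multiplication by the a_j is encoded by
    tails: a class at stage k is the sequence of its images at all later stages.
    Addition and scaling are then pointwise, and two tails are identified when
    they agree from some stage on. *)
Definition chain_pred : {pred nat -> Q^o} :=
  fun x => `[< eventually (fun j => x j.+1 = a j * x j) >].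

Lemma chain_pred_closed : submod_closed chain_pred.
Proof.
split=> [|r x y /asboolP xE /asboolP yE]; apply/asboolP.
  by apply: eventuallyT => j; exact: esym (mulr0 _).
apply: (eventually2 xE yE) => j xj yj.
rewrite -[LHS]/(r * x j.+1 + y j.+1) -[RHS]/(a j * (r * x j + y j)).
by rewrite xj yj; ring.
Qed.
HB.instance Definition _ :=
  GRing.isSubmodClosed.Build Q (nat -> Q^o) chain_pred chain_pred_closed.

Record chain := Chain { chain_val :> nat -> Q^o; _ : chain_val \in chain_pred }.
HB.instance Definition _ := [isSub for chain_val].
HB.instance Definition _ := [Choice of chain by <:].
HB.instance Definition _ := [SubChoice_isSubLmodule of chain by <:].

Definition null_pred : {pred chain} :=
  fun x => `[< eventually (fun j => x j = 0) >].

Lemma null_pred_closed : submod_closed null_pred.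
Proof.
split=> [|r x y /asboolP x0 /asboolP y0]; apply/asboolP.
  exact: eventuallyT.
apply: (eventually2 x0 y0) => j xj yj.
by rewrite -[LHS]/(r * x j + y j) xj yj mulr0 addr0.
Qed.

Definition bass : lmodType Q := mod_quot null_pred_closed.
Definition bass_pi : {linear chain -> bass} := mod_quot_pi null_pred_closed.

Lemma bass_piP (x y : chain) :
  bass_pi x = bass_pi y <-> eventually (fun j => x j = y j).
Proof.
rewrite mod_quot_piP; split=> [/asboolP xy|xy]; last apply/asboolP.
  by apply: (eventually1 xy) => j /subr0_eq.
by apply: (eventually1 xy) => j xyj; rewrite -[LHS]/(x j - y j) xyj subrr.
Qed.

Definition bass_rep (u : bass) : chain := sval (cid (mod_quot_surj u)).

Lemma bass_repK u : bass_pi (bass_rep u) = u.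
Proof. by rewrite /bass_rep; case: cid. Qed.

Lemma bass_repD u v :
  eventually (fun j => bass_rep (u + v) j = bass_rep u j + bass_rep v j).
Proof. by apply/(bass_piP _ (_ + _)); rewrite linearD !bass_repK. Qed.

Lemma bass_repZ r u : eventually (fun j => bass_rep (r *: u) j = r * bass_rep u j).
Proof. by apply/(bass_piP _ (r *: _)); rewrite linearZ /= !bass_repK. Qed.

Lemma bass_rep0 : eventually (fun j => bass_rep 0 j = 0).
Proof. by apply/(bass_piP _ 0); rewrite linear0 bass_repK. Qed.

(** The image of 1 placed at stage k; the value 0 before stage k is arbitrary. *)
Definition chain_gen_fun (k : nat) : nat -> Q^o :=
  fun j => if (j < k)%N then 0 else \prod_(k <= i < j) a i.

Lemma chain_gen_funE k j : (k <= j)%N ->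
  chain_gen_fun k j = \prod_(k <= i < j) a i :> Q.
Proof. by move=> kj; rewrite /chain_gen_fun ltnNge kj. Qed.

Lemma chain_gen_subproof k : chain_gen_fun k \in chain_pred.
Proof.
apply/asboolP; exists k => j kj; rewrite !chain_gen_funE ?leqW //.
by rewrite big_nat_recr //= mulrC.
Qed.
Definition chain_gen k : chain := Chain (chain_gen_subproof k).
Definition bass_gen k : bass := bass_pi (chain_gen k).

(** From the stage k on at which a tail is compatible, it is determined by its value
    at k, hence is a multiple of the k-th generator. *)
Lemma bass_rep_gen u : eventually (fun k => u = bass_rep u k *: bass_gen k).
Proof.
have [k xE] : eventually (fun j => bass_rep u j.+1 = a j * bass_rep u j).
  by apply/asboolP/(valP (bass_rep u)).
exists k => l kl; rewrite -linearZ -[LHS]bass_repK; apply/bass_piP; exists l.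
elim=> [|j IH].
  rewrite leqn0 => /eqP l0; subst l; rewrite -[RHS]/(_ * chain_gen_fun _ _).
  by rewrite chain_gen_funE // big_geq // mulr1.
rewrite leq_eqVlt => /predU1P[<-|]; last rewrite ltnS => lj.
  by rewrite -[RHS]/(_ * chain_gen_fun _ _) chain_gen_funE // big_geq // mulr1.
rewrite xE ?(leq_trans kl) // IH // -[LHS]/(_ * (_ * chain_gen_fun _ _)).
rewrite -[RHS]/(_ * chain_gen_fun _ _) !chain_gen_funE ?leqW //.
by rewrite big_nat_recr //=; ring.
Qed.

Lemma bass_gen_prod k : bass_gen 0 = (\prod_(i < k) a i) *: bass_gen k.
Proof.
rewrite -linearZ; apply/bass_piP; exists k => j kj.
rewrite -[LHS]/(chain_gen_fun _ _) -[RHS]/(_ * chain_gen_fun _ _).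
by rewrite !chain_gen_funE // -(big_mkord xpredT) -big_cat_nat.
Qed.

Section TensorValue.
Variable M : lmodType Q.

(** The stage k of the element of the direct limit of M -> M -> ... (along the a_j)
    to which a tensor over the Bass module corresponds. *)
Definition tensor_val (s : seq (bass * M)) (k : nat) : M :=
  \sum_(p <- s) (bass_rep p.1 k : Q) *: p.2.

Lemma tensor_val_eq s t : tensor_eq s t ->
  eventually (fun k => tensor_val s k = tensor_val t k).
Proof.
elim=> {s t} [s|s t _ st|s t u _ st _ tu|s s' t t' _ ss' _ tt'|s t
             |x x' y|x y y'|r x y|y].
- exact: eventuallyT.
- by apply: (eventually1 st).
- by apply: (eventually2 st tu) => k ->.
- by apply: (eventually2 ss' tt') => k sk tk; rewrite /tensor_val !big_cat; congr (_ + _).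
- by apply: eventuallyT => k; rewrite /tensor_val !big_cat /= addrC.
- apply: (eventually1 (bass_repD x x')) => k xk.
  by rewrite /tensor_val !big_cons !big_nil !addr0 xk scalerDl.
- by apply: eventuallyT => k; rewrite /tensor_val !big_cons !big_nil !addr0 scalerDr.
- apply: (eventually1 (bass_repZ r x)) => k xk.
  by rewrite /tensor_val !big_cons !big_nil !addr0 xk scalerA mulrC.
- apply: (eventually1 bass_rep0) => k xk.
  by rewrite /tensor_val big_cons big_nil xk scale0r addr0.
Qed.

(** All the left factors become multiples of one generator at a late enough stage,
    which collapses a sum of tensors to a single pure tensor. *)
Lemma tensor_eq_gen s :
  eventually (fun k => tensor_eq s [:: (bass_gen k, tensor_val s k)]).
Proof.
elim: s => [|[u m] s IH].
  apply: eventuallyT => k; rewrite /tensor_val big_nil; apply: TensorSym.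
  rewrite -(scale0r 0); apply: TensorTrans (TensorSym (TensorZ _ _ _)) _.
  by rewrite scale0r; exact: Tensor0.
apply: (eventually2 IH (bass_rep_gen u)) => k sk uk.
rewrite /tensor_val big_cons; apply: TensorTrans (TensorSym (TensorDr _ _ _)).
apply: (@TensorCat _ _ _ [:: _] [:: _]) => //=.
by rewrite [in X in tensor_eq X]uk; exact: TensorZ.
Qed.

(** The Bass module tensored with M is the direct limit of M -> M -> ..., so that
    equality of tensors can be tested in M itself. *)
Lemma tensor_eqP s t :
  tensor_eq s t <-> eventually (fun k => tensor_val s k = tensor_val t k).
Proof.
split=> [|st]; first exact: tensor_val_eq.
have tg : eventually (fun k => tensor_eq t [:: (bass_gen k, tensor_val s k)]).
  by apply: (eventually2 (tensor_eq_gen t) st) => k tk ->.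
have [k /(_ k (leqnn k))[sk tk]] : eventually (fun k =>
    tensor_eq s [:: (bass_gen k, tensor_val s k)] /\
    tensor_eq t [:: (bass_gen k, tensor_val s k)]).
  by apply: (eventually2 (tensor_eq_gen s) tg).
exact: TensorTrans sk (TensorSym tk).
Qed.

End TensorValue.

(** By [tensor_eqP] equality of tensors is equality in M at late stages, which an
    injective map reflects. *)
Lemma flat_bass : flat bass.
Proof.
move=> M N f f_inj s t /tensor_eqP fst; apply/tensor_eqP.
apply: (eventually1 fst) => k fk; apply: f_inj.
suff fE (r : seq (bass * M)) :
    f (tensor_val r k) = tensor_val [seq (p.1, f p.2) | p <- r] k by rewrite !fE.
by rewrite /tensor_val raddf_sum big_map; apply: eq_bigr => p _; rewrite /= linearZ.
Qed.

End BassModule.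

(** A section h of the projection from sequences onto the Bass module sends the
    generator of stage 0 to a sequence which at some k has the value
    a_0 ... a_(k-1); this generator being a_0 ... a_k times that of stage k + 1,
    the same value is divisible by a_0 ... a_k. *)
Lemma perfect_dcc (Q : comNzRingType) (a : nat -> Q) : perfect Q ->
  exists n b, \prod_(i < n) a i = b * \prod_(i < n.+1) a i.
Proof.
move=> /(_ _ (@flat_bass Q a)).
move=> /(_ _ _ (bass_pi a) idfun)[u|h hK].
  by exists (bass_rep u); exact: bass_repK.
have [k] : eventually (fun j => h (bass_gen a 0) j = chain_gen a 0 j).
  by apply/bass_piP; exact: hK.
move=> /(_ _ (leqnn k)).
rewrite {1}(bass_gen_prod a k.+1) linearZ => hE.
exists k, (h (bass_gen a k.+1) k); rewrite -(big_mkord xpredT).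
by rewrite -[LHS](chain_gen_funE a (leq0n k)) -[LHS]hE mulrC.
Qed.

(** * Ideals of zero-divisors modulo a subperfect ideal *)

Lemma subperfect_dcc (A : comNzRingType) (a : nat -> A) : subperfect A ->
  exists n s b, GRing.lreg s /\ s * \prod_(i < n) a i = b * \prod_(i < n.+1) a i.
Proof.
pose q x : total_quot A := \pi_(total_quot A) (x, nonzerodiv1 A).
have qM : {morph q : x y / x * y}.
  by move=> x y; rewrite /q !piE; apply/eqP/frac_eqP => /=; rewrite !mulr1.
have q1 : q 1 = 1 by rewrite /q !piE.
move=> /(perfect_dcc (q \o a))[n [b]].
rewrite -!(big_morph q qM q1); elim/quotW: b => -[b s].
rewrite [RHS]piE => /eqP/frac_eqP /=; rewrite !mulr1 => e.
by exists n, (sval s), b; split; [exact: nonzerodivP|rewrite -e mulrC].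
Qed.

Section RelativeIdeals.
Variable R : comNzRingType.
Implicit Types (I J : idealr R) (P : prime_idealr R).

(** Quotients R/J are handled inside R throughout, so that the primes that occur
    are primes of R and no ideal has to be pulled back from a quotient. *)
Definition regular_mod J x : Prop := forall y, x * y \in J -> y \in J.

Lemma ideal_quot_pi_eq0 J x : (\pi_{ideal_quot J} x = 0) <-> (x \in J).
Proof.
rewrite -[X in X \in J]subr0 Quotient.idealrBE.
by rewrite (rmorph0 \pi_{ideal_quot J}); split=> /eqP.
Qed.

Lemma regular_modM J x y :
  regular_mod J x -> regular_mod J y -> regular_mod J (x * y).
Proof. by move=> Jx Jy z; rewrite -mulrA => /Jx/Jy. Qed.

Lemma regular_mod1 J : regular_mod J 1.
Proof. by move=> y; rewrite mul1r. Qed.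

Lemma subperfect_dcc_mod J (a : nat -> R) : subperfect {ideal_quot J} ->
  exists n s b, regular_mod J s /\
    s * \prod_(i < n) a i - b * \prod_(i < n.+1) a i \in J.
Proof.
move=> /(subperfect_dcc (\pi_{ideal_quot J} \o a))[n [s [b]]].
elim/quotW: s => s; elim/quotW: b => b [sreg e]; exists n, s, b; split.
  move=> y /ideal_quot_pi_eq0; rewrite rmorphM => sy0.
  by apply/ideal_quot_pi_eq0/sreg; rewrite sy0 mulr0.
apply/ideal_quot_pi_eq0; apply/eqP; rewrite rmorphB !rmorphM !rmorph_prod.
by rewrite subr_eq0; apply/eqP.
Qed.

(** The form in which the chain condition is used: multiplying step by step while
    staying in T, one reaches a u whose further multiples u * v in T generate,
    up to a denominator, the same ideal as u modulo J.  If there were no such u,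
    the choices of v would form a sequence contradicting the chain condition. *)
Lemma dcc_stop J (T : R -> Prop) : subperfect {ideal_quot J} -> T 1 ->
  exists2 u, T u & forall v, T (u * v) ->
    exists s b, regular_mod J s /\ u * (s - b * v) \in J.
Proof.
move=> Jsub T1; apply: contrapT => noStop.
have /choice[f fP] u : exists v, T u -> T (u * v) /\
    forall s b, regular_mod J s -> u * (s - b * v) \notin J.
  have [Tu|] := pselect (T u); last by exists 0.
  apply: contrapT => nov; apply: noStop; exists u => // v Tuv.
  apply: contrapT => nosb; apply: nov; exists v => _; split=> // s b Js.
  by apply/negP => suJ; apply: nosb; exists s, b.
pose u := fix u n := if n is m.+1 then u m * f (u m) else 1.
have Tu n : T (u n) by elim: n => //= n /fP[].
have uE n : \prod_(i < n) f (u i) = u n.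
  by elim: n => [|n IH]; rewrite ?big_ord0 // big_ord_recr /= IH.
have [n [s [b [Js]]]] := subperfect_dcc_mod (f \o u) Jsub.
rewrite !uE /= => suJ; have [_ /(_ s b Js)/negP] := fP _ (Tu n); apply.
by rewrite mulrBr mulrC mulrCA.
Qed.

Lemma prime_ideal_of (S : {pred R}) :
  idealr_closed S -> prime_idealr_closed S -> exists P : prime_idealr R, P =i S.
Proof.
move=> Sid Spr.
by exists (HB.pack_for (prime_idealr R) (S : R -> bool)
  (isIdealr.Build R S Sid) (isPrimeIdealrClosed.Build R S Spr)).
Qed.

(** Krull's theorem: an ideal that contains J and is maximal among those avoiding
    the multiplicative set S is prime. *)
Lemma prime_disjoint J (S : R -> Prop) :
  S 1 -> (forall x y, S x -> S y -> S (x * y)) -> (forall x, x \in J -> ~ S x) ->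
  exists2 P : prime_idealr R, {subset J <= P} & forall x, x \in P -> ~ S x.
Proof.
move=> S1 SM JS.
(* The condition is imposed on the union of X and J rather than on X, so that
   the empty chain has an upper bound. *)
pose with_J (X : set R) (x : R) : Prop := X x \/ x \in J.
pose good (X : set R) := (forall a x y, with_J X x -> with_J X y ->
  with_J X (a * x + y)) /\ forall x, with_J X x -> ~ S x.
have [|X [[Xid XS] Xmax]] := @Zorn_bigcup R good.
  move=> F Fgood Ftot; split=> [a x y|x [[X FX Xx]|/JS//]]; last first.
    by apply: (Fgood _ FX).2; left.
  have up X z : F X -> with_J X z -> with_J (\bigcup_(X in F) X)%classic z.
    by move=> FX [Xz|]; [left; exists X|right].
  move=> [[X FX Xx]|xJ] [[Y FY Yy]|yJ].
  - have [XY|YX] := Ftot _ _ FX FY.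
      by apply: (up Y _ FY); apply: (Fgood _ FY).1; left=> //; apply: XY.
    by apply: (up X _ FX); apply: (Fgood _ FX).1; left=> //; apply: YX.
  - by apply: (up X _ FX); apply: (Fgood _ FX).1; [left|right].
  - by apply: (up Y _ FY); apply: (Fgood _ FY).1; [right|left].
  - by right; rewrite rpredD // idealMr.
have Xadj u : ~ with_J X u -> exists a z, with_J X z /\ S (a * u + z).
  move=> Xu; pose Y : set R := fun y => exists a z, with_J X z /\ y = a * u + z.
  have X0 : with_J X 0 by right; exact: idealr0.
  have XY : (X `<=` Y)%classic.
    by move=> x Xx; exists 0, x; rewrite mul0r add0r; split=> //; left.
  have JY y : with_J Y y -> Y y.
    by case=> // Jy; exists 0, y; rewrite mul0r add0r; split=> //; right.
  apply: contrapT => noS; apply: (Xmax Y).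
    split=> // /(_ u) YX; apply: Xu; left; apply: YX.
    by exists 1, 0; rewrite mul1r addr0.
  split=> [a _ _ /JY[b [z [Xz ->]]] /JY[c [w [Xw ->]]]|_ /JY[a [z [Xz ->]]]].
    by left; exists (a * b + c), (a * z + w); split; [exact: Xid|ring].
  by move=> Sx; apply: noS; exists a, z.
have XM a x : with_J X x -> with_J X (a * x).
  by move=> Xx; rewrite -[_ * _]addr0; apply: Xid => //; right; exact: idealr0.
have XD x y : with_J X x -> with_J X y -> with_J X (x + y).
  by move=> Xx Xy; rewrite -[x]mul1r; exact: Xid.
have [||P PE] := @prime_ideal_of (fun x => `[< with_J X x >]).
- split=> [||a u v /asboolP Xu /asboolP Xv]; apply/asboolP.
  + by right; exact: idealr0.
  + by move=> /XS.
  + exact: Xid.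
- move=> u v /asboolP Xuv; apply/orP; apply: contrapT => /orP.
  rewrite negb_or => /andP[/asboolP/Xadj[a [z [Xz Sz]]] /asboolP/Xadj[b [w [Xw Sw]]]].
  apply: (XS _ _ (SM _ _ Sz Sw)).
  have -> : (a * u + z) * (b * v + w) =
    (a * b) * (u * v) + ((b * v + w) * z + (a * u) * w) by ring.
  by apply: Xid => //; apply: XD; apply: XM.
exists P => x; first by move=> Jx; rewrite PE; apply/asboolP; right.
by rewrite PE => /asboolP/XS.
Qed.

Lemma prime_of_zero_divisors J I : {subset J <= I} ->
  (forall x, x \in I -> ~ regular_mod J x) ->
  exists2 P : prime_idealr R, {subset I <= P} & forall x, x \in P -> ~ regular_mod J x.
Proof.
move=> JI; apply: prime_disjoint; [exact: regular_mod1|exact: regular_modM].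
Qed.

(** If p in P were outside P', the chain of powers of p would stop outside P':
    u * (s - b * p) lies in J, hence in P', for some u outside P' and some s
    regular modulo J.  Then s - b * p, and with it s, would lie in P. *)
Lemma zero_divisors_minimal J P P' : subperfect {ideal_quot J} ->
  (forall x, x \in P -> ~ regular_mod J x) ->
  {subset J <= P'} -> {subset P' <= P} -> {subset P <= P'}.
Proof.
move=> Jsub Pzd JP' P'P p Pp; apply: contrapT => /negP P'p.
have [|u P'u] := dcc_stop (T := fun u => u \notin P') Jsub; first by rewrite idealr1.
move=> /(_ p)[|s [b [Js /JP']]]; first by rewrite prime_idealrM negb_or P'u.
rewrite prime_idealrM (negbTE P'u) /= => /P'P Psp; apply: (Pzd s) => //.
by rewrite -(subrK (b * p) s) rpredD // idealMr.
Qed.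

(** Two extremal choices.  First u outside P, such that all multiples of u outside
    P divide u up to a denominator; u plays the role of the idempotent that cuts
    out the local factor of Q(R/J) at P.  Secondly c, with annihilator modulo J
    inside P, whose multiples by elements of P lose this property; c gives a
    socle element of that factor.  Each x in P then has x * c killed by some v
    outside P, and u turns the various v into a single multiplier: u * c. *)
Lemma zero_divisors_annihilated J P : subperfect {ideal_quot J} ->
  {subset J <= P} -> (forall x, x \in P -> ~ regular_mod J x) ->
  exists2 c, c \notin J & forall x, x \in P -> x * c \in J.
Proof.
move=> Jsub JP Pzd.
have [|u Pu uP] := dcc_stop (T := fun u => u \notin P) Jsub; first by rewrite idealr1.
have [|c cP cstop] := dcc_stop (T := fun c => forall y, c * y \in J -> y \in P) Jsub.
  by move=> y; rewrite mul1r => /JP.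
exists (u * c) => [|x Px].
  by apply/negP; rewrite mulrC => /cP; rewrite (negbTE Pu).
(* Otherwise s - b * x would annihilate c modulo J, and s would lie in P. *)
have [v Pv cxv] : exists2 v, v \notin P & c * x * v \in J.
  apply: contrapT => nov; have [|s [b [Js /cP Psx]]] := cstop x.
    by move=> y cxy; apply: contrapT => /negP Py; apply: nov; exists y.
  by apply: (Pzd s) => //; rewrite -(subrK (b * x) s) rpredD // idealMr.
have [|s [b [Js suv]]] := uP v; first by rewrite prime_idealrM negb_or Pu.
apply: Js; have -> : s * (x * (u * c)) =
  c * x * (u * (s - b * v)) + (b * u) * (c * x * v) by ring.
by rewrite rpredD // idealMr.
Qed.

(** The multiplicative set generated by x and the complement of P avoids J, because
    x is regular modulo J; a prime avoiding it lies inside P and omits x. *)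
Lemma prime_below J P x : {subset J <= P} -> x \in P -> regular_mod J x ->
  exists P' : prime_idealr R, [/\ {subset J <= P'}, {subset P' <= P} & x \notin P'].
Proof.
move=> JP Px Jx.
have Jxn n : regular_mod J (x ^+ n).
  by elim: n => [|n IH]; [exact: regular_mod1|rewrite exprS; exact: regular_modM].
pose S y := exists u n, u \notin P /\ y = u * x ^+ n.
have [||y Jy|P' JP' P'S] := @prime_disjoint J S.
- by exists 1, 0%N; rewrite idealr1 mulr1.
- move=> _ _ [u [n [Pu ->]]] [v [m [Pv ->]]]; exists (u * v), (n + m)%N.
  by rewrite prime_idealrM negb_or Pu Pv exprD; split=> //; ring.
- move=> [u [n [Pu yE]]]; move: Jy; rewrite yE mulrC => /Jxn/JP.
  by rewrite (negbTE Pu).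
exists P'; split=> // [y P'y|]; last first.
  by apply/negP => /P'S; apply; exists 1, 1%N; rewrite idealr1 mul1r.
by apply: contrapT => /negP Py; apply: (P'S y) => //; exists y, 0%N; rewrite mulr1.
Qed.

End RelativeIdeals.

(** * Regular sequences and chains of primes *)

Section RegularSequences.
Variable R : comNzRingType.
Implicit Types (I J : idealr R) (P : prime_idealr R) (xs : seq R).

Lemma seq_ideal_sub I xs : {subset xs <= I} -> {subset seq_ideal xs <= I}.
Proof.
move=> xsI _ /asboolP[c ->]; apply: rpred_sum => i _.
by apply: idealMr; apply: xsI; exact: mem_nth.
Qed.

Lemma regular_ideal_sub I xs (h : regular_seq xs) :
  {subset xs <= I} -> {subset regular_ideal h <= I}.
Proof. exact: seq_ideal_sub. Qed.

Lemma seq_ideal_nil (y : R) : (y \in seq_ideal [::]) <-> y = 0.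
Proof.
split=> [/asboolP[c ->]|->]; first by rewrite big_ord0.
by apply/asboolP; exists (fun=> 0); rewrite big_ord0.
Qed.

Lemma seq_ideal_rcons xs x y :
  y \in seq_ideal (rcons xs x) <-> exists a, y - a * x \in seq_ideal xs.
Proof.
have sumE (c : nat -> R) : \sum_(i < size (rcons xs x)) c i * (rcons xs x)`_i =
    \sum_(i < size xs) c i * xs`_i + c (size xs) * x.
  rewrite size_rcons big_ord_recr /= nth_rcons ltnn eqxx; congr (_ + _).
  by apply: eq_bigr => i _; rewrite nth_rcons ltn_ord.
split=> [/asboolP[c ->]|[a /asboolP[c yE]]].
  by exists (c (size xs)); apply/asboolP; exists c; rewrite sumE addrK.
pose d i := if (i < size xs)%N then c i else a.
apply/asboolP; exists d; rewrite sumE {2}/d ltnn -[LHS](subrK (a * x)) yE; congr (_ + _).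
by apply: eq_bigr => i _; rewrite /d ltn_ord.
Qed.

Lemma sub_seq_ideal_rcons xs x : {subset seq_ideal xs <= seq_ideal (rcons xs x)}.
Proof. by move=> y xsy; apply/seq_ideal_rcons; exists 0; rewrite mul0r subr0. Qed.

Lemma mem_seq_ideal xs : {subset xs <= seq_ideal xs}.
Proof.
elim/last_ind: xs => // xs x IH y; rewrite mem_rcons inE => /predU1P[->|/IH].
  apply/seq_ideal_rcons; exists 1; rewrite mul1r subrr.
  by apply/asboolP; exists (fun=> 0); rewrite big1 // => i _; rewrite mul0r.
exact: sub_seq_ideal_rcons.
Qed.

Lemma regular_seq_nil : regular_seq (nil : seq R).
Proof.
by split=> //; apply/negP => /seq_ideal_nil/eqP; rewrite oner_eq0.
Qed.

Lemma regular_seq_rcons xs x : regular_seq (rcons xs x) ->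
  exists h : regular_seq xs, regular_mod (regular_ideal h) x.
Proof.
move=> [xs1 xsreg]; have h : regular_seq xs.
  split=> [|j jxs y]; first by apply: contra xs1; exact: sub_seq_ideal_rcons.
  have /(_ _ y) := xsreg j; rewrite size_rcons nth_rcons jxs -cats1.
  by rewrite takel_cat ?(ltnW jxs) //; apply; exact: ltnW.
exists h => y; have /(_ _ y) := xsreg (size xs).
by rewrite size_rcons nth_rcons ltnn eqxx -cats1 take_size_cat //; apply.
Qed.

(** Sitting inside a proper ideal is what keeps the extended sequence from generating
    the unit ideal. *)
Lemma regular_seq_rcons_in I xs x (h : regular_seq xs) :
  {subset xs <= I} -> x \in I -> regular_mod (regular_ideal h) x ->
  regular_seq (rcons xs x).
Proof.
move=> xsI Ix xreg; split=> [|j].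
  apply/negP => /(@seq_ideal_sub I); rewrite idealr1 => /(_ _)/notF; apply.
  by move=> y; rewrite mem_rcons inE => /predU1P[->|/xsI].
rewrite size_rcons ltnS leq_eqVlt => /predU1P[->|jxs] y.
  by rewrite nth_rcons ltnn eqxx -cats1 take_size_cat //; exact: xreg.
rewrite nth_rcons jxs -cats1 takel_cat ?(ltnW jxs) //; exact: h.2.
Qed.

Lemma maximal_regular_seq_zero_divisors I xs (h : regular_seq xs) :
  maximal_regular_seq I xs -> forall x, x \in I -> ~ regular_mod (regular_ideal h) x.
Proof.
move=> [_ xsI xsmax] x Ix xreg; apply: (xsmax x Ix).
exact: regular_seq_rcons_in xsI Ix xreg.
Qed.

Lemma zero_divisors_maximal_regular_seq I xs (h : regular_seq xs) :
  {subset xs <= I} -> (forall x, x \in I -> ~ regular_mod (regular_ideal h) x) ->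
  maximal_regular_seq I xs.
Proof.
move=> xsI Izd; split=> // x Ix /regular_seq_rcons[h' xreg].
exact: (Izd x Ix).
Qed.

Lemma prime_chain_rcons P P' k x : prime_chain P' k -> {subset P' <= P} ->
  x \in P -> x \notin P' -> prime_chain P k.+1.
Proof.
move=> [c [ck cS]] P'P Px P'x.
exists (fun i => if (i <= k)%N then c i else P); rewrite ltnn; split=> // i.
rewrite ltnS => ik; have /predU1P[->|{}ik] : (i == k) || (i < k)%N by rewrite -leq_eqVlt.
  2: by rewrite (ltnW ik) ik; exact: cS.
rewrite leqnn ltnn; split=> [y|/(_ x Px)]; first by rewrite ck => /P'P.
by rewrite ck (negbTE P'x).
Qed.

(** Going down from P: the last term of the sequence is regular modulo the others,
    so [prime_below] gives a smaller prime that still contains them. *)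
Lemma prime_chain_regular_seq xs P :
  regular_seq xs -> {subset xs <= P} -> prime_chain P (size xs).
Proof.
elim/last_ind: xs P => [|xs x IH] P.
  by move=> _ _; exists (fun=> P).
move=> /regular_seq_rcons[h xreg] xsP; rewrite size_rcons.
have xs_P : {subset xs <= P} by move=> y yxs; apply: xsP; rewrite mem_rcons inE yxs orbT.
have Px : x \in P by apply: xsP; rewrite mem_rcons mem_head.
have [P' [xsP' P'P P'x]] := prime_below (regular_ideal_sub xs_P) Px xreg.
apply: prime_chain_rcons P'P Px P'x; apply: IH => // y /mem_seq_ideal; exact: xsP'.
Qed.

(** Going up the chain: if the sequence found in one prime could not be extended
    inside the next one, the latter would consist of zero-divisors modulo it and
    be minimal over it, contradicting the strict inclusion. *)
Lemma regular_seq_prime_chain P k : regularly_subperfect R -> prime_chain P k ->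
  exists xs, [/\ regular_seq xs, {subset xs <= P} & size xs = k].
Proof.
move=> Rsub; elim: k P => [|k IH] P [c [ck cS]].
  by exists [::]; split=> //; exact: regular_seq_nil.
have [|xs [h xsck <-]] := IH (c k); first by exists c; split=> // i /ltnW/cS.
have [ckP Pck] := cS k (ltnSn k).
have {ckP} ckP : {subset c k <= P} by move=> x; rewrite -ck => /ckP.
have {Pck} Pck : ~ {subset P <= c k} by move=> H; apply: Pck => x; rewrite ck => /H.
apply: contrapT => noxs; apply: Pck.
apply: (zero_divisors_minimal (Rsub _ h)) => // [x Px xreg|].
  2: exact: regular_ideal_sub.
have xsP : {subset xs <= P} by move=> y /xsck/ckP.
apply: noxs; exists (rcons xs x); split; first exact: regular_seq_rcons_in xsP Px xreg.
  by move=> y; rewrite mem_rcons inE => /predU1P[->|/xsP].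
by rewrite size_rcons.
Qed.

End RegularSequences.

(** * Shifting the degree of Ext along a regular element *)

Section Ext.
Variables (R : comNzRingType) (M : lmodType R).
Implicit Types N : lmodType R.
Local Notation d := (free_res_diff M).

Definition Ext_eq0 N t : Prop :=
  forall phi : {linear free_res M t -> N}, ext_cocycle phi -> ext_coboundary phi.

Lemma Ext_neq0P N t : Ext_neq0 M N t <-> ~ Ext_eq0 N t.
Proof.
split=> [[phi phiZ phiB] E0|nE0]; first exact: phiB (E0 _ phiZ).
apply: contrapT => nE; apply: nE0 => phi phiZ.
by apply: contrapT => phiB; apply: nE; exists phi.
Qed.

Lemma free_linear_eq (K : choiceType) N (f g : {linear {freeg K / R} -> N}) :
  (forall k, f << k >> = g << k >>) -> f =1 g.
Proof.
move=> fg D; rewrite [LHS]free_lift_ext [RHS]free_lift_ext.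
by congr (free_lift _ _); exact/funext.
Qed.

Lemma free_res_diff_lift t (K : choiceType)
    (f : {linear {freeg K / R} -> free_res M t}) :
  (forall y, free_cover (syzygy M t) (f y) = 0) ->
  exists s : {linear {freeg K / R} -> free_res M t.+1}, forall y, d t (s y) = f y.
Proof.
move=> f0; have /choice[s sP] k : exists y, d t y = f << k >>.
  exact/free_res_diffE.
exists (free_lift s : {linear _ -> free_res M t.+1}).
apply: (free_linear_eq (f := d t \o free_lift s)) => k.
by rewrite -[LHS]/(d t (free_lift s << k >>)) free_liftU sP.
Qed.

Lemma free_res_diff_diff t y : d t (d t.+1 y) = 0.
Proof. by apply/free_res_exact; exists y. Qed.

(** Multiplication by x lifts the zero map of M to the free resolution, so it is null
    homotopic.  Only its restriction to boundaries is recorded: there the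
    homotopy formula x = d s + s d loses its second term. *)
Lemma annihilator_homotopy x t : (forall m : M, x *: m = 0) ->
  exists s : {linear free_res M t -> free_res M t.+1},
    forall y, d t (s (d t y)) = x *: d t y.
Proof.
move=> xM; elim: t => [|t [s sP]].
  have [|s sP] := @free_res_diff_lift 0 M (x \*: idfun).
    by move=> y; rewrite /= linearZ /= xM.
  by exists s => y; exact: sP.
have [|s' s'P] := @free_res_diff_lift t.+1 _ ((x \*: idfun) \- (s \o d t)).
  move=> y; apply/free_res_diffE/free_res_exact.
  transitivity (x *: d t y - d t (s (d t y))); last by rewrite sP subrr.
  by apply: etrans (linearB _ _ _) _; rewrite -linearZ.
exists s' => y; apply: etrans (s'P _) _.
by rewrite -[LHS]/(x *: d t.+1 y - s (d t (d t.+1 y))) free_res_diff_diff linear0 subr0.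
Qed.

Lemma ext_coboundary_cocycle N t (phi : {linear free_res M t -> N}) :
  ext_coboundary phi -> ext_cocycle phi.
Proof.
case: t phi => [|t] phi => [phi0 y|[psi phiE] y]; first exact: phi0.
by rewrite phiE free_res_diff_diff linear0.
Qed.

Lemma ext_coboundary_comp N N' (f : {linear N -> N'}) t
    (phi : {linear free_res M t -> N}) (phi' : {linear free_res M t -> N'}) :
  (forall y, phi' y = f (phi y)) -> ext_coboundary phi -> ext_coboundary phi'.
Proof.
case: t phi phi' => [|t] phi phi' phi'E => [phi0 y|[psi phiE]].
  by rewrite phi'E phi0 linear0.
by exists (f \o psi) => y; rewrite phi'E phiE.
Qed.

Lemma Ext_neq0_retract N N' (f : {linear N -> N'}) (g : {linear N' -> N}) t :
  cancel g f -> Ext_neq0 M N' t -> Ext_neq0 M N t.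
Proof.
move=> gK [phi phiZ phiB]; exists (g \o phi) => [y|].
  by apply: etrans (congr1 g (phiZ y)) _; exact: linear0.
by move=> gphiB; apply: phiB; apply: (ext_coboundary_comp (f := f) _ gphiB) => y /=.
Qed.

(** A 0-cocycle is a linear map from M to N, which x must kill. *)
Lemma Ext0_eq0 N x : (forall m : M, x *: m = 0) ->
  (forall n : N, x *: n = 0 -> n = 0) -> Ext_eq0 N 0.
Proof.
move=> xM xN phi phiZ y; apply: xN; rewrite -linearZ.
have [|z <-] := (free_res_diffE (x *: y : free_res M 0)).1; last exact: phiZ.
by rewrite linearZ /= xM.
Qed.

(** Here N' stands for N/xN.  Keeping it abstract lets R/(x_1, ..., x_(i+1)) serve as
    the quotient of R/(x_1, ..., x_i) by x_(i+1). *)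
Section Shift.
Variables (N N' : lmodType R) (pi : {linear N -> N'}) (x : R).
Hypothesis pi_surj : forall n', exists n, pi n = n'.
Hypothesis pi_ker : forall n, pi n = 0 <-> exists n0, n = x *: n0.
Hypothesis xN : forall n : N, x *: n = 0 -> n = 0.

Lemma scale_regular_inj n1 n2 : x *: n1 = x *: n2 -> n1 = n2 :> N.
Proof. by move=> e; apply/subr0_eq/xN; rewrite scalerBr e subrr. Qed.

Lemma pi_scale n : pi (x *: n) = 0.
Proof. by apply/pi_ker; exists n. Qed.

Lemma divide_linear (K : choiceType) (psi : {linear {freeg K / R} -> N}) :
  (forall y, pi (psi y) = 0) ->
  exists theta : {linear {freeg K / R} -> N}, forall y, psi y = x *: theta y.
Proof.
move=> psi0; have /choice[t tP] k : exists n0, psi << k >> = x *: n0.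
  exact/pi_ker.
exists (free_lift t : {linear _ -> N}).
by apply: (free_linear_eq (g := x \*: free_lift t)) => k; rewrite /= free_liftU tP.
Qed.

(** Free modules are projective, so a primitive of psi modulo x lifts to N and leaves
    a remainder divisible by x. *)
Lemma ext_coboundary_lift t (psi : {linear free_res M t -> N}) :
  ext_coboundary (pi \o psi) ->
  exists psi' theta : {linear free_res M t -> N},
    ext_coboundary psi' /\ forall y, psi y = psi' y + x *: theta y.
Proof.
case: t psi => [|t] psi => [psi0|[chi' chi'E]].
  have [theta thetaE] := divide_linear psi0.
  by exists \0, theta; split=> // y; rewrite thetaE add0r.
have [chi chiE] := free_projective chi' pi_surj.
have [|theta thetaE] := @divide_linear _ (psi \- (chi \o d t)).
  move=> y; apply: etrans (linearB _ _ _) _.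
  by rewrite chiE -chi'E subrr.
exists (chi \o d t), theta; split; first by exists chi.
by move=> y; rewrite -thetaE -[RHS]/(_ + (psi y - _)) addrC subrK.
Qed.

(** The part Ext^t(M, N/xN) -> Ext^(t+1)(M, N) -> Ext^(t+1)(M, N) of the long exact
    sequence, where the second map, multiplication by x, is zero.  The homotopy
    s gives x * phi as the coboundary of phi o s, which is a cocycle modulo x;
    correcting it by a coboundary makes it divisible by x, and dividing yields a
    primitive of phi. *)
Lemma Ext_eq0_up t : (forall m : M, x *: m = 0) -> Ext_eq0 N' t -> Ext_eq0 N t.+1.
Proof.
move=> xM E0 phi phiZ; have [s sP] := annihilator_homotopy t xM.
have phis y : phi (s (d t y)) = x *: phi y.
  have [|z zE] := (free_res_exact (s (d t y) - x *: y)).1.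
    by rewrite linearB sP linearZ; exact: subrr.
  by apply/subr0_eq; rewrite -linearZ -linearB -zE phiZ.
have [|psi' [theta [psi'B psiE]]] := @ext_coboundary_lift t (phi \o s).
  by apply: E0 => y; rewrite -[LHS]/(pi (phi (s (d t y)))) phis pi_scale.
exists theta => y; apply: scale_regular_inj; rewrite -phis.
by apply: etrans (psiE (d t y)) _; rewrite (ext_coboundary_cocycle psi'B) add0r.
Qed.

(** The part Ext^t(M, N) -> Ext^t(M, N/xN) -> Ext^(t+1)(M, N) of the long exact
    sequence: theta is the connecting class of phi'. *)
Lemma Ext_eq0_down t : Ext_eq0 N t -> Ext_eq0 N t.+1 -> Ext_eq0 N' t.
Proof.
move=> E0 E1 phi' phi'Z; have [phi phiE] := free_projective phi' pi_surj.
have [|theta thetaE] := @divide_linear _ (phi \o d t).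
  by move=> y; rewrite -[LHS]/(pi (phi (d t y))) phiE phi'Z.
have [|eta etaE] := E1 theta.
  move=> y; apply: xN; rewrite -thetaE -[LHS]/(phi (d t (d t.+1 y))).
  by rewrite free_res_diff_diff linear0.
apply: (ext_coboundary_comp (phi := phi \- (x \*: eta)) (f := pi)) => [y|].
  by rewrite /= linearB pi_scale subr0 phiE.
by apply: E0 => y; rewrite -[LHS]/(phi (d t y) - x *: eta (d t y)) -etaE -thetaE subrr.
Qed.

Lemma Ext_eq0_below_up k : (forall m : M, x *: m = 0) ->
  (forall t, (t < k)%N -> Ext_eq0 N' t) -> forall t, (t < k.+1)%N -> Ext_eq0 N t.
Proof. by move=> xM E0 [_|t /E0]; [exact: Ext0_eq0 xN|exact: Ext_eq0_up]. Qed.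

End Shift.
End Ext.

(** * Ext of R/I along a regular sequence in I *)

Section IdealQuotLinear.
Variable R : comNzRingType.
Implicit Type J : idealr R.

Lemma ideal_quot_pi_linear J : linear (\pi_{ideal_quot J} : R^o -> {ideal_quot J}).
Proof. by move=> a u v; rewrite rmorphD rmorphM. Qed.

Definition quot_pi J : {linear R^o -> {ideal_quot J}} :=
  HB.pack_for {linear R^o -> {ideal_quot J}}
    (\pi_{ideal_quot J} : R^o -> {ideal_quot J})
    (GRing.isLinear.Build R R^o {ideal_quot J} _ _ (@ideal_quot_pi_linear J)).

Lemma ideal_quot_lift J (N : lmodType R) (f : {linear R^o -> N}) :
  (forall y, y \in J -> f y = 0) ->
  exists q : {linear {ideal_quot J} -> N}, forall y, q (quot_pi J y) = f y.
Proof.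
move=> fJ; pose q (u : {ideal_quot J}) := f (repr u).
have qE y : q (quot_pi J y) = f y.
  apply/subr0_eq; rewrite -linearB fJ // Quotient.idealrBE.
  by rewrite /quot_pi /= reprK.
have qlin : linear q.
  move=> a; elim/quotW=> u; elim/quotW=> v.
  rewrite -[\pi u]/(quot_pi J u) -[\pi v]/(quot_pi J v) -linearP !qE linearP //.
by exists (HB.pack_for {linear {ideal_quot J} -> N} q
  (GRing.isLinear.Build R {ideal_quot J} N _ q qlin)).
Qed.

End IdealQuotLinear.

Section ExtRegularSequence.
Variables (R : comNzRingType) (I : idealr R).
Implicit Types (J : idealr R) (xs : seq R).
Local Notation M := ({ideal_quot I} : lmodType R).

Lemma quot_pi_surj J (n : {ideal_quot J}) : exists y, n = quot_pi J y.
Proof. by exists (repr n); rewrite -[LHS]reprK. Qed.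

Lemma quot_pi_eq0 J (y : R) : quot_pi J y = 0 <-> y \in J.
Proof. exact: ideal_quot_pi_eq0. Qed.

Lemma scale_quot_pi J (a y : R) : a *: quot_pi J y = quot_pi J (a * y).
Proof. by rewrite -linearZ. Qed.

Lemma ideal_scale_quot x (m : M) : x \in I -> x *: m = 0.
Proof.
have [y ->] := quot_pi_surj m => Ix.
by rewrite scale_quot_pi; apply/quot_pi_eq0; rewrite mulrC idealMr.
Qed.

(** Multiplication by c induces a linear map R/I -> R/J that does not kill 1. *)
Lemma Ext0_neq0 J c : c \notin J -> (forall x, x \in I -> x * c \in J) ->
  Ext_neq0 M ({ideal_quot J} : lmodType R) 0.
Proof.
move=> Jc Ic; have [|q qE] := @ideal_quot_lift _ I {ideal_quot J} (c \*: quot_pi J).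
  by move=> y Iy; rewrite /= scale_quot_pi mulrC; apply/quot_pi_eq0/Ic.
exists (q \o free_cover M) => [y|q0].
  have e : free_cover M (free_res_diff M 0 y) = 0 by apply/free_res_exact0; exists y.
  by apply: etrans (congr1 q e) _; exact: linear0.
have := q0 << quot_pi I 1 >>; rewrite /= free_liftU qE /= scale_quot_pi mulr1.
by move/quot_pi_eq0; rewrite (negbTE Jc).
Qed.

Lemma quot_regular_step xs x (h : regular_seq xs) (hx : regular_seq (rcons xs x)) :
  regular_mod (regular_ideal h) x ->
  exists pi : {linear {ideal_quot (regular_ideal h)} ->
                      {ideal_quot (regular_ideal hx)}},
  [/\ forall n', exists n, pi n = n', forall n, pi n = 0 <-> exists n0, n = x *: n0
    & forall n : {ideal_quot (regular_ideal h)}, x *: n = 0 -> n = 0].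
Proof.
move=> xreg; have [|pi piE] := @ideal_quot_lift _ (regular_ideal h)
    {ideal_quot (regular_ideal hx)} (quot_pi (regular_ideal hx)).
  by move=> y Jy; apply/quot_pi_eq0; exact: sub_seq_ideal_rcons.
exists pi; split=> [n'|n|n].
- by have [y ->] := quot_pi_surj n'; exists (quot_pi _ y); exact: piE.
- have [y ->] := quot_pi_surj n; rewrite piE; split=> [/quot_pi_eq0|[n0]].
    move=> /seq_ideal_rcons[a ya]; exists (quot_pi _ a).
    rewrite scale_quot_pi; apply/subr0_eq; rewrite -linearB mulrC.
    exact/quot_pi_eq0.
  have [a ->] := quot_pi_surj n0; rewrite -piE => ->.
  rewrite scale_quot_pi piE; apply/quot_pi_eq0/seq_ideal_rcons; exists a.
  by rewrite mulrC subrr; exact: (idealr0 (regular_ideal h)).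
have [y ->] := quot_pi_surj n; rewrite scale_quot_pi.
by move=> /quot_pi_eq0/xreg/quot_pi_eq0.
Qed.

(** Iterates the shift from R/(xs) down to R/(0), which is then replaced by the
    regular module R^o.  Non-vanishing in degree k can only be transported
    together with vanishing below k, hence the joint statement. *)
Lemma Ext_regular_shift xs (h : regular_seq xs) k : {subset xs <= I} ->
  (forall t, (t < k)%N -> Ext_eq0 M {ideal_quot (regular_ideal h)} t) ->
  (forall t, (t < size xs + k)%N -> Ext_eq0 M R^o t) /\
  (Ext_neq0 M {ideal_quot (regular_ideal h)} k -> Ext_neq0 M R^o (size xs + k)).
Proof.
elim/last_ind: xs h k => [|xs x IH] h k xsI E0.
  pose p := quot_pi (regular_ideal h).
  have [|q qE] := @ideal_quot_lift _ (regular_ideal h) R^o idfun.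
    by move=> y /seq_ideal_nil.
  have pK : cancel p q by move=> y; rewrite qE.
  have qK : cancel q p by move=> n; have [y ->] := quot_pi_surj n; rewrite qE.
  split=> [t /E0 Nt|]; last exact: Ext_neq0_retract qK.
  apply: contrapT => /Ext_neq0P/(Ext_neq0_retract pK)/Ext_neq0P; exact.
have [h' xreg] := regular_seq_rcons h.
have [pi [pi_surj pi_ker xN]] := quot_regular_step h xreg.
have xM (m : M) : x *: m = 0.
  by apply: ideal_scale_quot; apply: xsI; rewrite mem_rcons mem_head.
have E0' := Ext_eq0_below_up pi_surj pi_ker xN xM E0.
have xs_I : {subset xs <= I}.
  by move=> y yxs; apply: xsI; rewrite mem_rcons inE yxs orbT.
have [E0R EkR] := IH h' k.+1 xs_I E0'; rewrite size_rcons addSnnS; split=> //.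
move=> /Ext_neq0P Ek; apply: EkR; apply/Ext_neq0P => Ek1; apply: Ek.
exact: (Ext_eq0_down pi_surj pi_ker xN (E0' k (ltnSn k)) Ek1).
Qed.

Lemma Ext_eq0_regular_seq xs t : regular_seq xs -> {subset xs <= I} ->
  (t < size xs)%N -> Ext_eq0 M R^o t.
Proof.
move=> h xsI txs; have [|E0 _] := @Ext_regular_shift xs h 0 xsI; first by [].
by apply: E0; rewrite addn0.
Qed.

(** By maximality I consists of zero-divisors modulo (xs), so it lies in a prime
    which a single element c multiplies into (xs). *)
Lemma Ext_neq0_maximal_regular_seq xs : regularly_subperfect R ->
  maximal_regular_seq I xs -> Ext_neq0 M (R^o : lmodType R) (size xs).
Proof.
move=> Rsub xsmax; have [h xsI _] := xsmax.
have Izd := maximal_regular_seq_zero_divisors (h := h) xsmax.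
have [P IP Pzd] := prime_of_zero_divisors (regular_ideal_sub xsI) Izd.
have JP : {subset regular_ideal h <= P}.
  by move=> y /(regular_ideal_sub xsI); exact: IP.
have [c Jc cP] := zero_divisors_annihilated (Rsub _ h) JP Pzd.
have [|_] := @Ext_regular_shift xs h 0 xsI; first by [].
by rewrite addn0; apply; apply: Ext0_neq0 Jc _ => x /IP/cP.
Qed.

Lemma size_maximal_regular_seq xs ys : regularly_subperfect R ->
  maximal_regular_seq I xs -> regular_seq ys -> {subset ys <= I} ->
  (size ys <= size xs)%N.
Proof.
move=> Rsub xsmax h ysI; rewrite leqNgt; apply/negP => xsys.
by have /Ext_neq0P := Ext_neq0_maximal_regular_seq Rsub xsmax; apply;
  exact: Ext_eq0_regular_seq h ysI xsys.
Qed.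

Lemma exists_maximal_regular_seq b :
  (forall xs, regular_seq xs -> {subset xs <= I} -> (size xs <= b)%N) ->
  exists xs, maximal_regular_seq I xs.
Proof.
move=> bnd; apply: contrapT => nomax.
have long k : exists xs, [/\ regular_seq xs, {subset xs <= I} & size xs = k].
  elim: k => [|k [xs [h xsI <-]]].
    by exists [::]; split=> //; exact: regular_seq_nil.
  apply: contrapT => noext; apply: nomax; exists xs; split=> // x Ix hx.
  apply: noext; exists (rcons xs x); rewrite size_rcons; split=> // y.
  by rewrite mem_rcons inE => /predU1P[->|/xsI].
by have [xs [h xsI xsb]] := long b.+1; have := bnd xs h xsI; rewrite xsb ltnn.
Qed.

End ExtRegularSequence.

(** * Heights *)

Lemma ideal_height_unique (R : comNzRingType) (I : idealr R) m n :
  ideal_height I m -> ideal_height I n -> m = n.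
Proof.
move=> [[P IP Pm] Im] [[P' IP' P'n] In]; apply/eqP.
by rewrite eqn_leq (Im P' IP' n P'n) (In P IP m Pm).
Qed.

(** A prime P above I that consists of zero-divisors modulo (xs) attains the height:
    xs is maximal in P as well, so by [size_maximal_regular_seq] no regular
    sequence in P, and hence no chain of primes below P, is longer. *)
Lemma height_maximal_regular_seq (R : comNzRingType) (I : idealr R)
    (xs : seq R) :
  regularly_subperfect R -> maximal_regular_seq I xs -> ideal_height I (size xs).
Proof.
move=> Rsub xsmax; have [h xsI _] := xsmax.
have Izd := maximal_regular_seq_zero_divisors (h := h) xsmax.
have [P IP Pzd] := prime_of_zero_divisors (regular_ideal_sub xsI) Izd.
split=> [|P' IP' k [_]]; last first.
  by apply; apply: prime_chain_regular_seq => // y /xsI/IP'.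
have xsP : {subset xs <= P} by move=> y /xsI/IP.
exists P => //; split=> [|k]; first exact: prime_chain_regular_seq.
move=> /(regular_seq_prime_chain Rsub)[ys [hys ysP <-]].
have xsmaxP : maximal_regular_seq P xs.
  exact: (zero_divisors_maximal_regular_seq (h := h)).
exact: size_maximal_regular_seq Rsub xsmaxP hys ysP.
Qed.

Theorem theorem3p6 (R : comNzRingType) (hR : regularly_subperfect R)
    (I : idealr R) (n : nat) :
  [<-> ideal_height I n;
       (exists xs : seq R, maximal_regular_seq I xs) /\
       (forall xs : seq R, maximal_regular_seq I xs -> size xs = n);
       exists2 xs : seq R, maximal_regular_seq I xs & size xs = n;
       Ext_neq0 ({ideal_quot I} : lmodType R) (R^o : lmodType R) n /\
       (forall t : nat, Ext_neq0 ({ideal_quot I} : lmodType R)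
          (R^o : lmodType R) t -> (n <= t)%N)].
Proof.
tfae.
- move=> hI; have [P IP [_ Pn]] := hI.1.
  split=> [|xs xsmax].
    apply: (@exists_maximal_regular_seq _ _ n) => xs h xsI; apply: Pn.
    by apply: prime_chain_regular_seq h _ => y /xsI/IP.
  exact: ideal_height_unique (height_maximal_regular_seq hR xsmax) hI.
- by move=> [[xs xsmax] xsn]; exists xs; last exact: xsn.
- move=> [xs xsmax <-]; have [h xsI _] := xsmax.
  split=> [|t /Ext_neq0P Et]; first exact: Ext_neq0_maximal_regular_seq.
  by rewrite leqNgt; apply/negP => txs; apply: Et; exact: Ext_eq0_regular_seq h xsI txs.
- move=> [/Ext_neq0P En Emin].
  have [|xs xsmax] := @exists_maximal_regular_seq R I n.
    by move=> xs h xsI; rewrite leqNgt; apply/negP => nxs; apply: En;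
      exact: Ext_eq0_regular_seq h xsI nxs.
  suff <- : size xs = n by exact: height_maximal_regular_seq.
  have [h xsI _] := xsmax; apply/eqP; rewrite eqn_leq.
  rewrite (Emin _ (Ext_neq0_maximal_regular_seq hR xsmax)) andbT leqNgt.
  by apply/negP => nxs; apply: En; exact: Ext_eq0_regular_seq h xsI nxs.
Qed.
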